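(* (a) Let $X$ be a quasi-Banach space with the Bounded Approximation Property and let $Y$ be an ultrasummand. If $K_0(X,Y)$ is finite, then so is $K(X,Y)$. (b) Suppose $X$ is a $\mathcal K$-space and $Y$ is an ultrasummand with the Bounded Approximation Property. If $K_0(X,Y)$ is finite, then so is $K(X,Y)$.
   Context: Scalars are real or complex, with scalar field $\mathbb K$. A quasi-Banach space is a complete quasi-normed space (a quasi-norm satisfies the axioms of a norm with the triangle inequality replaced by $\|x+y\|\le\Delta(\|x\|+\|y\|)$ for some constant $\Delta$). Operators are continuous linear maps. A map $F:X\to Y$ between quasi-Banach spaces is homogeneous if $F(\lambda x)=\lambda F(x)$ for all scalars $\lambda$ and $x\in X$; a homogeneous map is bounded if $\|F\|:=\sup_{\|x\|\le1}\|F(x)\|<\infty$. $F$ is quasilinear if it is homogeneous and there is a constant $Q$ with $\|F(x+y)-F(x)-F(y)\|_Y\le Q(\|x\|_X+\|y\|_X)$ for all $x,y\in X$; the least such $Q$ is denoted $Q(F)$. $K_0(X,Y)$ is the infimum of those constants $C$ for which the following holds: if $F:X\to Y$ is a bounded quasilinear map, then there is a linear (not necessarily continuous) map $L:X\to Y$ such that $\|F-L\|\le C\,Q(F)$. $K(X,Y)$ is defined in the same way omitting the word ''bounded''. (The value is $\infty$ if there is no such $C$.) A quasi-Banach space $X$ is a $\mathcal K$-space if $K(X,\mathbb K)<\infty$; equivalently, every quasilinear function $X\to\mathbb K$ is the sum of a linear map and a bounded homogeneous map. A quasi-Banach space $X$ has the Bounded Approximation Property (BAP) if there is a uniformly bounded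 net of finite rank operators on $X$ converging pointwise to the identity on $X$. Equivalently, there is a constant $\lambda$ such that for every finite-dimensional subspace $E$ of $X$ there is a finite rank operator $u_E:X\to X$ with $u_E(x)=x$ for every $x\in E$ and $\|u_E\|\le\lambda$. Given a quasi-Banach space $Y$, a set $I$ and an ultrafilter $\mathscr U$ on $I$, the ultrapower $Y_{\mathscr U}$ is the quotient, with the quotient quasi-norm, of the space $\ell_\infty(I,Y)$ of bounded families in $Y$ (with the sup quasi-norm) by the subspace of families $(y_i)$ with $\lim_{\mathscr U}\|y_i\|=0$. The diagonal embedding $\delta:Y\to Y_{\mathscr U}$ sends $y$ to the class of the constant family $(y)$. An ultrasummand is a quasi-Banach space $Y$ that is complemented in all its ultrapowers through the diagonal embedding, i.e. for every ultrapower $Y_{\mathscr U}$ there is an operator $p:Y_{\mathscr U}\to Y$ with $p\circ\delta=\mathrm{Id}_Y$. *)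

(* Defs.v *)
From HB Require Import structures.
From mathcomp Require Import all_boot all_order all_algebra.
From mathcomp Require Import generic_quotient ring_quotient complex.
From mathcomp Require Import all_classical all_reals all_analysis.

Set Implicit Arguments.
Unset Strict Implicit.
Unset Printing Implicit Defensive.
Import Order.TTheory GRing.Theory Num.Theory.
Import numFieldNormedType.Exports.

Local Open Scope classical_set_scope.
Local Open Scope ring_scope.
Local Open Scope quotient_scope.

Inductive scalar_kind := RealScalars | ComplexScalars.

Definition scalar (R : realType) (k : scalar_kind) : numFieldType :=
  match k with
  | RealScalars => (R : numFieldType)
  | ComplexScalars => (R[i]%C : numFieldType)
  end.

(* The library norm of [scalar R k] takes its values in [scalar R k] itself;
   the modulus is the same quantity, seen as an element of [R]. *)
Definition modulus (R : realType) (k : scalar_kind) : scalar R k -> R :=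
  match k with
  | RealScalars => fun a : R => `|a|
  | ComplexScalars => fun a : R[i]%C => Normc.normc a
  end.

Section modulus_theory.
Variables (R : realType) (k : scalar_kind).
Implicit Types a b : scalar R k.

Lemma modulus_ge0 a : 0 <= modulus a.
Proof. by case: k a => [a|[x y]] /=; rewrite ?sqrtr_ge0. Qed.

Lemma modulus_eq0 a : modulus a = 0 -> a = 0.
Proof.
case: k a => [a|a] /=; first by move/normr0P/eqP.
exact: Normc.eq0_normc.
Qed.

Lemma modulus0 : modulus (0 : scalar R k) = 0.
Proof. by case: k => /=; [rewrite normr0|exact: Normc.normc0]. Qed.

Lemma modulusM a b : modulus (a * b) = modulus a * modulus b.
Proof.
by case: k a b => [a b|a b] /=; [rewrite normrM|exact: Normc.normcM].
Qed.

Lemma le_modulusD a b : modulus (a + b) <= modulus a + modulus b.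
Proof. by case: k a b => [a b|a b] /=; [exact: ler_normD|exact: le_normcD]. Qed.

Lemma modulusV a : modulus a^-1 = (modulus a)^-1.
Proof. by case: k a => [a|a] /=; [rewrite normfV|exact: Normc.normcV]. Qed.

Lemma modulus1 : modulus (1 : scalar R k) = 1.
Proof. by case: k => /=; [rewrite normr1|exact: Normc.normc1]. Qed.

Lemma modulusN a : modulus (- a) = modulus a.
Proof. by case: k a => [a|a] /=; [rewrite normrN|exact: normcN]. Qed.

Lemma entourage_modulus :
  @entourage (scalar R k)^o = entourage_ (ball_ (@modulus R k)).
Proof.
rewrite -entourage_ballE; case: k => //=; apply/seteqP; split=> A /=.
- case=> e /=; rewrite ltcE /= => /andP[/eqP ie re] sA.
  exists (complex.Re e) => //= -[x y] /= xy; apply: sA => /=.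
  by rewrite /ball /= ltcE /= ie eqxx.
- case=> e /= e0 sA; exists (e%:C)%C; first by rewrite /= ltcR.
  by move=> -[x y]; rewrite /ball /= => xy; apply: sA; rewrite /= -ltcR.
Qed.

End modulus_theory.

(* The topology is the one for which the balls of the quasi-norm form a base of
   neighborhoods; they need not be open, as a quasi-norm may be discontinuous. *)
HB.mixin Record UniformLmodule_isQuasiNormed (R : realType) (k : scalar_kind) V
    of GRing.Lmodule (scalar R k) V & Uniform V := {
  qnorm : V -> R;
  qnorm_ge0 : forall x, 0 <= qnorm x;
  qnorm_eq0 : forall x, qnorm x = 0 -> x = 0;
  qnormZ : forall (a : scalar R k) x, qnorm (a *: x) = modulus a * qnorm x;
  qnormD_ex : exists Delta, forall x y,
    qnorm (x + y) <= Delta * (qnorm x + qnorm y);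
  entourage_qnorm : entourage = entourage_ (ball_ qnorm)
}.

#[short(type="quasiNormedType")]
HB.structure Definition QuasiNormed (R : realType) (k : scalar_kind) :=
  {V of GRing.Lmodule (scalar R k) V & Uniform V &
        UniformLmodule_isQuasiNormed R k V}.

(* The library's [completeType] is the same condition on a type that is moreover
   pointed. *)
HB.mixin Record QuasiNormed_isComplete (R : realType) (k : scalar_kind) V
    of QuasiNormed R k V := {
  cauchy_ex_lim : forall F : set_system V,
    ProperFilter F -> cauchy F -> exists x : V, F --> x
}.

#[short(type="quasiBanachType")]
HB.structure Definition QuasiBanach (R : realType) (k : scalar_kind) :=
  {V of QuasiNormed R k V & QuasiNormed_isComplete R k V}.

HB.factory Record Lmodule_isQuasiNormed (R : realType) (k : scalar_kind) V
    of GRing.Lmodule (scalar R k) V := {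
  qnorm : V -> R;
  qnorm_ge0 : forall x, 0 <= qnorm x;
  qnorm_eq0 : forall x, qnorm x = 0 -> x = 0;
  qnormZ : forall (a : scalar R k) x, qnorm (a *: x) = modulus a * qnorm x;
  qnormD_ex : exists Delta, forall x y,
    qnorm (x + y) <= Delta * (qnorm x + qnorm y)
}.

HB.builders Context R k V of Lmodule_isQuasiNormed R k V.

Let ent : set_system (V * V) := entourage_ (ball_ qnorm).

Let N0 : qnorm 0 = 0.
Proof. by rewrite -(scale0r 0) qnormZ modulus0 mul0r. Qed.

Let NN x : qnorm (- x) = qnorm x.
Proof. by rewrite -scaleN1r qnormZ modulusN modulus1 mul1r. Qed.

Let ent_filter : Filter ent.
Proof.
apply: filter_from_filter; first by exists 1 => /=.
move=> e d /= e0 d0; exists (Num.min e d); first by rewrite /= lt_min e0.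
by move=> [x y] /=; rewrite lt_min => /andP[].
Qed.

Let ent_diagonal A : ent A -> diagonal `<=` A.
Proof.
case=> e /= e0 sA [x y] /= xy; apply: sA => /=; move: xy; rewrite /diagonal /=.
by move=> ->; rewrite subrr N0.
Qed.

Let ent_inv A : ent A -> ent A^-1%relation.
Proof.
case=> e e0 sA; exists e => // -[x y] /= xy; apply: sA => /=.
by rewrite -NN opprB.
Qed.

Let ent_split A :
  ent A -> exists2 B, ent B & (B \; B `<=` A)%relation.
Proof.
case=> e /= e0 sA; have [D hD] := qnormD_ex.
have D0 : 0 < Num.max D 1 by rewrite lt_max ltr01 orbT.
pose d := e / 2 / Num.max D 1.
have d0 : 0 < d by rewrite !divr_gt0.
exists [set xy | ball_ qnorm xy.1 d xy.2]; first by exists d.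
move=> [x y] [z /= xz zy]; apply: sA => /=.
rewrite -(subrKA z); apply: (le_lt_trans (hD _ _)).
apply: (@le_lt_trans _ _ (Num.max D 1 * (qnorm (x - z) + qnorm (z - y)))).
  by rewrite ler_wpM2r ?addr_ge0 ?qnorm_ge0 // le_max lexx.
have -> : e = Num.max D 1 * (d + d).
  by rewrite /d -mulrDl -splitr mulrC divfK // gt_eqF.
by rewrite ltr_pM2l // ltrD.
Qed.

HB.instance Definition _ :=
  isUniform.Build V ent_filter ent_diagonal ent_inv ent_split.
HB.instance Definition _ := UniformLmodule_isQuasiNormed.Build R k V
  qnorm_ge0 qnorm_eq0 qnormZ qnormD_ex erefl.

HB.end.

Section qnorm_theory.
Variables (R : realType) (k : scalar_kind) (V : quasiNormedType R k).
Implicit Types x y : V.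

Lemma qnorm0 : qnorm (0 : V) = 0.
Proof. by rewrite -(scale0r 0) qnormZ modulus0 mul0r. Qed.

Lemma qnormN x : qnorm (- x) = qnorm x.
Proof. by rewrite -scaleN1r qnormZ modulusN modulus1 mul1r. Qed.

Lemma qnormD_ex1 : exists2 D : R, 1 <= D &
  forall x y, qnorm (x + y) <= D * (qnorm x + qnorm y).
Proof.
have [D hD] := @qnormD_ex R k V; exists (Num.max D 1).
  by rewrite le_max lexx orbT.
move=> x y; apply: (le_trans (hD x y)).
by rewrite ler_wpM2r ?addr_ge0 ?qnorm_ge0 // le_max lexx.
Qed.

End qnorm_theory.

Section scalar_quasiNormed.
Variables (R : realType) (k : scalar_kind).

Let D_ex : exists Delta, forall x y : (scalar R k)^o,
  modulus (x + y : scalar R k) <=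
  Delta * (modulus (x : scalar R k) + modulus (y : scalar R k)).
Proof. by exists 1 => x y; rewrite mul1r le_modulusD. Qed.

HB.instance Definition _ :=
  UniformLmodule_isQuasiNormed.Build R k (scalar R k)^o
    (@modulus_ge0 R k) (@modulus_eq0 R k) (@modulusM R k) D_ex
    (@entourage_modulus R k).

End scalar_quasiNormed.

Section linfty.
Variables (R : realType) (k : scalar_kind) (I : Type) (Y : quasiNormedType R k).

Definition bounded_family : {pred I -> Y} :=
  [pred y | `[< exists M : R, forall i, qnorm (y i) <= M >]].

Lemma bounded_familyP (y : I -> Y) :
  reflect (exists M : R, forall i, qnorm (y i) <= M) (y \in bounded_family).
Proof. exact: asboolP. Qed.

Lemma bounded_family_submod : submod_closed bounded_family.
Proof.
have [D D1 hD] := qnormD_ex1 Y; split.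
  by apply/bounded_familyP; exists 0 => i; rewrite qnorm0.
move=> a y z /bounded_familyP[M hM] /bounded_familyP[N hN].
apply/bounded_familyP; exists (D * (modulus a * M + N)) => i.
apply: (le_trans (hD _ _)); rewrite ler_wpM2l ?(le_trans ler01) // lerD //.
by rewrite qnormZ ler_wpM2l // modulus_ge0.
Qed.

HB.instance Definition _ := GRing.isSubmodClosed.Build (scalar R k) (I -> Y)
  bounded_family bounded_family_submod.

Record linfty := Linfty { linfty_val :> I -> Y ;
                          _ : linfty_val \in bounded_family }.

HB.instance Definition _ := [isSub for linfty_val].
HB.instance Definition _ := [Choice of linfty by <:].
HB.instance Definition _ := [SubChoice_isSubLmodule of linfty by <:].

Definition linfty_norm (y : linfty) : R := sup (range (fun i => qnorm (y i))).

Lemma le_linfty_norm (y : linfty) i : qnorm (y i) <= linfty_norm y.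
Proof.
apply: ub_le_sup; last by exists i.
have /bounded_familyP[M hM] := valP y.
by exists M => _ [j _ <-]; exact: hM.
Qed.

Lemma linfty_norm_le (y : linfty) (M : R) :
  0 <= M -> (forall i, qnorm (y i) <= M) -> linfty_norm y <= M.
Proof.
move=> M0 hM; rewrite /linfty_norm.
have [->|/set0P ne] := eqVneq (range (fun i => qnorm (y i))) set0.
  by rewrite sup0.
by apply: ge_sup => // _ [i _ <-]; exact: hM.
Qed.

Let norm_ge0 y : 0 <= linfty_norm y.
Proof.
rewrite /linfty_norm; have [->|] := eqVneq (range (fun i => qnorm (y i))) set0.
  by rewrite sup0.
by case/set0P => _ [i _ _]; apply: le_trans (le_linfty_norm y i); exact: qnorm_ge0.
Qed.

Let norm_eq0 y : linfty_norm y = 0 -> y = 0.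
Proof.
move=> y0; apply/val_inj/funext => i; apply/qnorm_eq0/eqP.
by rewrite eq_le qnorm_ge0 andbT -y0; exact: le_linfty_norm.
Qed.

Let normZ_le (a : scalar R k) y : linfty_norm (a *: y) <= modulus a * linfty_norm y.
Proof.
apply: linfty_norm_le => [|i]; first by rewrite mulr_ge0 ?modulus_ge0.
have -> : (a *: y) i = a *: y i by [].
by rewrite qnormZ ler_wpM2l ?modulus_ge0 ?le_linfty_norm.
Qed.

Let normZ (a : scalar R k) y : linfty_norm (a *: y) = modulus a * linfty_norm y.
Proof.
apply/eqP; rewrite eq_le normZ_le /=.
have [->|a0] := eqVneq a 0; first by rewrite modulus0 mul0r.
have ma0 : 0 < modulus a.
  by rewrite lt_def modulus_ge0 andbT; apply: contra_neq a0; exact: modulus_eq0.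
rewrite -ler_pdivlMl // -modulusV -[in leLHS](scale1r y) -(mulVf a0) -scalerA.
exact: normZ_le.
Qed.

Let normD_ex : exists Delta, forall y z,
  linfty_norm (y + z) <= Delta * (linfty_norm y + linfty_norm z).
Proof.
have [D D1 hD] := qnormD_ex1 Y; have D0 := le_trans ler01 D1.
exists D => y z; apply: linfty_norm_le => [|i]; first by rewrite mulr_ge0 ?addr_ge0.
apply: (le_trans (hD (y i) (z i))).
by rewrite ler_wpM2l // lerD ?le_linfty_norm.
Qed.

HB.instance Definition _ := Lmodule_isQuasiNormed.Build R k linfty
  norm_ge0 norm_eq0 normZ normD_ex.

Lemma const_bounded (y : Y) : (fun _ : I => y) \in bounded_family.
Proof. by apply/bounded_familyP; exists (qnorm y). Qed.

Definition linfty_const (y : Y) : linfty := Linfty (const_bounded y).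

End linfty.

Section ultrapower.
Variables (R : realType) (k : scalar_kind) (Y : quasiNormedType R k).
Variables (I : Type) (U : set_system I) (FU : UltraFilter U).

Definition null_family of UltraFilter U : {pred linfty I Y} :=
  [pred y : linfty I Y | `[< qnorm (y i) @[i --> U] --> (0 : R) >]].

Let N := null_family FU.

Lemma null_familyP (y : linfty I Y) :
  reflect (qnorm (y i) @[i --> U] --> (0 : R)) (y \in N).
Proof. exact: asboolP. Qed.

Lemma null_family_submod : submod_closed N.
Proof.
have [D D1 hD] := qnormD_ex1 Y; split.
  apply/null_familyP; rewrite (_ : (fun _ => _) = fun=> 0); first exact: cvg_cst.
  by apply/funext => i; exact: qnorm0.
move=> a y z /null_familyP y0 /null_familyP z0; apply/null_familyP.
apply: (@squeeze_cvgr _ _ _ _ (fun=> 0)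
    (fun i => D * (modulus a * qnorm (y i) + qnorm (z i)))).
- apply: nearW => i; rewrite qnorm_ge0 /=.
  by rewrite -qnormZ; exact: hD (a *: y i) (z i).
- exact: cvg_cst.
- rewrite -[X in _ --> X](mulr0 D); apply: cvgM; first exact: cvg_cst.
  rewrite -[X in _ --> X]addr0; apply: cvgD => //.
  by rewrite -[X in _ --> X](mulr0 (modulus a)); apply: cvgM => //; exact: cvg_cst.
Qed.

HB.instance Definition _ := GRing.isSubmodClosed.Build (scalar R k) (linfty I Y)
  N null_family_submod.

Definition ultrapower := Quotient.quot N.

HB.instance Definition _ := GRing.Zmodule.on ultrapower.

Definition uclass (y : linfty I Y) : ultrapower := \pi_(Quotient.quot N) y.

Implicit Types (x : ultrapower) (a b : scalar R k) (y z : linfty I Y).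

Let uclassP y z : uclass y = uclass z <-> y - z \in N.
Proof. by rewrite Quotient.idealrBE; split => [/eqP|/eqP]. Qed.

Let uclassK x : uclass (repr x) = x.
Proof. exact: reprK. Qed.

Let uclassD y z : uclass (y + z) = uclass y + uclass z.
Proof. exact: (raddfD \pi_(Quotient.quot N)). Qed.

Let uclass0 : uclass 0 = 0.
Proof. exact: (raddf0 \pi_(Quotient.quot N)). Qed.

Definition ultrapower_scale a x : ultrapower := uclass (a *: repr x).

Let scaleE a y : ultrapower_scale a (uclass y) = uclass (a *: y).
Proof. by apply/uclassP; rewrite -scalerBr rpredZ //; apply/uclassP. Qed.

Let scaleA a b x :
  ultrapower_scale a (ultrapower_scale b x) = ultrapower_scale (a * b) x.
Proof. by rewrite -(uclassK x) !scaleE scalerA. Qed.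

Let scale1 : left_id 1 ultrapower_scale.
Proof. by move=> x; rewrite -(uclassK x) scaleE scale1r. Qed.

Let scaleDr : right_distributive ultrapower_scale +%R.
Proof.
move=> a x x'; rewrite -(uclassK x) -(uclassK x').
by rewrite -uclassD !scaleE scalerDr uclassD.
Qed.

Let scaleDl x : {morph ultrapower_scale^~ x : a b / a + b}.
Proof. by move=> a b; rewrite -(uclassK x) !scaleE scalerDl uclassD. Qed.

HB.instance Definition _ := GRing.Zmodule_isLmodule.Build (scalar R k) ultrapower
  scaleA scale1 scaleDr scaleDl.

Lemma uclass_linear : linear uclass.
Proof. by move=> a y z; rewrite uclassD -scaleE. Qed.

Lemma uclass_eqP y z :
  uclass y = uclass z <-> qnorm (y i - z i) @[i --> U] --> (0 : R).
Proof. exact: (iff_trans (uclassP y z) (iff_sym (rwP (null_familyP (y - z))))). Qed.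

Lemma uclass_surj x : exists y, uclass y = x.
Proof. by exists (repr x); exact: uclassK. Qed.

Definition ultrapower_norm x : R :=
  inf [set qnorm y | y in [set y : linfty I Y | uclass y = x]].

Let norm_has_lb x :
  has_lbound [set qnorm y | y in [set y : linfty I Y | uclass y = x]].
Proof. by exists 0 => _ [y _ <-]; exact: qnorm_ge0. Qed.

Lemma ultrapower_norm_le y : ultrapower_norm (uclass y) <= qnorm y.
Proof. by apply: ge_inf => //; exists y. Qed.

Lemma le_ultrapower_norm x (M : R) :
  (forall y, uclass y = x -> M <= qnorm y) -> M <= ultrapower_norm x.
Proof.
move=> hM; apply: lb_le_inf; last by move=> _ [y yx <-]; exact: hM.
by have [y yx] := uclass_surj x; exists (qnorm y), y.
Qed.

Let norm_ge0 x : 0 <= ultrapower_norm x.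
Proof. by apply: le_ultrapower_norm => y _; exact: qnorm_ge0. Qed.

Let norm_lt x (e : R) : ultrapower_norm x < e ->
  exists2 y, uclass y = x & qnorm y < e.
Proof.
move=> /inf_lt[|_ [y yx <-] ye]; last by exists y.
by have [y yx] := uclass_surj x; exists (qnorm y), y.
Qed.

Let norm_eq0 x : ultrapower_norm x = 0 -> x = 0.
Proof.
move=> x0; have [y yx] := uclass_surj x; rewrite -yx -uclass0.
have [D D1 hD] := qnormD_ex1 Y; have D0 : 0 < D := lt_le_trans ltr01 D1.
apply/uclassP; rewrite subr0; apply/null_familyP/cvgrPdist_lt => e e0.
have d0 : 0 < e / 2 / D by rewrite !divr_gt0.
have [z zx zd] : exists2 z, uclass z = x & qnorm z < e / 2 / D.
  by apply: norm_lt; rewrite x0.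
have yz0 : qnorm ((y - z) i) @[i --> U] --> (0 : R).
  by apply/null_familyP/uclassP; rewrite yx zx.
move/cvgrPdist_lt : yz0 => /(_ _ d0).
apply: filterS => i /=; rewrite !sub0r !normrN !ger0_norm ?qnorm_ge0 // => yz.
have -> : y i = (y - z) i + z i by rewrite -[LHS](subrK (z i)).
apply: (le_lt_trans (hD _ _)); rewrite -ltr_pdivlMl // mulrC.
rewrite [in ltRHS](splitr e) mulrDl ltrD //.
by apply: le_lt_trans zd; exact: (le_linfty_norm z i).
Qed.

Let normZ_le a x : ultrapower_norm (a *: x) <= modulus a * ultrapower_norm x.
Proof.
have [->|a0] := eqVneq a 0.
  rewrite scale0r modulus0 mul0r -uclass0; apply: (le_trans (ultrapower_norm_le _)).
  by rewrite qnorm0.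
have ma0 : 0 < modulus a.
  by rewrite lt_def modulus_ge0 andbT; apply: contra_neq a0; exact: modulus_eq0.
rewrite -ler_pdivrMl //; apply: le_ultrapower_norm => y <-.
rewrite ler_pdivrMl // -qnormZ.
have -> : a *: uclass y = uclass (a *: y) by exact: scaleE.
exact: ultrapower_norm_le.
Qed.

Let normZ a x : ultrapower_norm (a *: x) = modulus a * ultrapower_norm x.
Proof.
apply/eqP; rewrite eq_le normZ_le /=.
have [->|a0] := eqVneq a 0; first by rewrite modulus0 mul0r.
have ma0 : 0 < modulus a.
  by rewrite lt_def modulus_ge0 andbT; apply: contra_neq a0; exact: modulus_eq0.
rewrite -ler_pdivlMl // -modulusV -[in leLHS](scale1r x) -(mulVf a0) -scalerA.
exact: normZ_le.
Qed.

Let normD_ex : exists Delta, forall x x',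
  ultrapower_norm (x + x') <= Delta * (ultrapower_norm x + ultrapower_norm x').
Proof.
have [D D1 hD] := qnormD_ex1 (linfty I Y); have D0 := lt_le_trans ltr01 D1.
exists D => x x'; rewrite -ler_pdivrMl // -lerBlDr.
apply: le_ultrapower_norm => y yx; rewrite lerBlDr -lerBlDl.
apply: le_ultrapower_norm => y' yx'; rewrite lerBlDl ler_pdivrMl //.
by rewrite -yx -yx' -uclassD; apply: le_trans (hD _ _); exact: ultrapower_norm_le.
Qed.

HB.instance Definition _ := Lmodule_isQuasiNormed.Build R k ultrapower
  norm_ge0 norm_eq0 normZ normD_ex.

Definition diagonal_embedding (y : Y) : ultrapower := uclass (linfty_const I y).

End ultrapower.

Arguments ultrapower {R k} Y {I U} FU.
Arguments diagonal_embedding {R k Y I U} FU y.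

Definition ultrasummand (R : realType) (k : scalar_kind)
    (Y : quasiBanachType R k) : Prop :=
  forall (I : Type) (U : set_system I) (FU : UltraFilter U),
  exists p : {linear ultrapower Y FU -> Y},
    continuous p /\ forall y, p (diagonal_embedding FU y) = y.

Section quasilinear.
Variables (R : realType) (k : scalar_kind) (X Y : quasiNormedType R k).
Implicit Types (F : X -> Y) (L : {linear X -> Y}).

Definition map_norm F : \bar R :=
  ereal_sup [set (qnorm (F x))%:E | x in [set x | qnorm x <= 1]].

Definition bounded_map F : Prop := (map_norm F < +oo)%E.

(* Negative constants are excluded so that a least one exists even if X = 0. *)
Definition quasilinear_constants F : set R :=
  [set Q | 0 <= Q /\
     forall x y, qnorm (F (x + y) - F x - F y) <= Q * (qnorm x + qnorm y)].

Definition quasilinear F : Prop :=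
  scalable F /\ quasilinear_constants F !=set0.

Definition quasilinear_const F : R := inf (quasilinear_constants F).

(* Negative constants are excluded so that the two infima below lie in
   [0, +oo] even if every quasilinear map has constant 0. *)
Definition K0_const : \bar R :=
  ereal_inf [set C%:E | C in [set C : R | 0 <= C /\
    forall F, quasilinear F -> bounded_map F ->
    exists L, (map_norm (F \- L)%R <= (C * quasilinear_const F)%:E)%E]].

Definition K_const : \bar R :=
  ereal_inf [set C%:E | C in [set C : R | 0 <= C /\
    forall F, quasilinear F ->
    exists L, (map_norm (F \- L)%R <= (C * quasilinear_const F)%:E)%E]].

End quasilinear.

Arguments K0_const {R k} X Y.
Arguments K_const {R k} X Y.

Definition K_space (R : realType) (k : scalar_kind)
    (X : quasiBanachType R k) : Prop :=
  (K_const X (scalar R k)^o < +oo)%E.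

Definition directed (D : Type) (le : D -> D -> Prop) : Prop :=
  [/\ inhabited D, forall d, le d d,
      forall d1 d2 d3, le d1 d2 -> le d2 d3 -> le d1 d3 &
      forall d1 d2, exists d, le d1 d /\ le d2 d].

Definition net_filter (D : Type) (le : D -> D -> Prop) : set_system D :=
  filter_from setT (fun d => [set e | le d e]).

Definition finite_rank (K : fieldType) (V W : lmodType K) (u : V -> W) : Prop :=
  exists (n : nat) (e : 'I_n -> W), forall x, exists c : 'I_n -> K,
    u x = \sum_i c i *: e i.

Definition bounded_approximation_property (R : realType) (k : scalar_kind)
    (X : quasiBanachType R k) : Prop :=
  exists (D : Type) (le : D -> D -> Prop) (u : D -> {linear X -> X}) (M : R),
  [/\ directed le,
      forall d, continuous (u d) /\ finite_rank (u d),
      forall d, (map_norm (u d) <= M%:E)%E &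
      forall x, u d x @[d --> net_filter le] --> x].

(* Main.v *)
From HB Require Import structures.
Require Import Defs.
From mathcomp Require Import all_boot all_order all_algebra complex ring.
From mathcomp Require Import all_classical all_reals all_analysis.

(** Each part approximates a quasilinear map [F], in a pointwise sense, by
    bounded quasilinear maps with the same constant up to a fixed factor.  The
    finiteness of the bounded constant gives for each approximant a linear map
    uniformly close to it, and the ultrasummand property of [Y] turns this
    family of linear maps into a single one.

    The gluing step is [ultrasummand_lift].  Suppose [G i x --> F x] along an
    ultrafilter, [l i] is eventually additive and homogeneous at any given
    vectors, and [G i x - l i x] is at most [B] times the quasi-norm of [x].
    The class of [(l i x)_i] in the ultrapower is linear in [x] and differs from
    the image of [F x] by at most that much, so applying a projection [p] of the
    ultrapower onto [Y] gives a linear map at distance at most [norm p * B] from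
    [F].  As [p] depends only on the ultrafilter, which is fixed before [F], the
    resulting constant is uniform in [F].

    When the domain [X] has the approximation property, let [u_d] be the net of
    finite rank operators.  A quasilinear map is bounded on finite-dimensional
    spaces, so [F \o u_d] is bounded and is close to a linear map [L].  But [F]
    may be discontinuous, so [F (u_d x)] need not tend to [F x].  On the span of
    finitely many independent vectors [e_i] one has, up to a multiple of
    [Q(F) * (norm x)],
    [F (u_d x) = F x + F (u_d x - x)], and with [x = \sum a_i e_i],
    [F (u_d x - x) = \sum a_i F (u_d e_i - e_i)] as soon as [d] is so large that
    the vectors [u_d e_i - e_i] are small compared with the constant relating
    coordinates to the quasi-norm of the span.  The right-hand side is linear in
    [x], so subtracting it from [L] gives a linear map on the span close to [F]
    itself ([bap_finite_linear_approx]).  These maps, indexed by the finite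
    subsets of [X], are glued with [G i = F].

    When the codomain [Y] has the approximation property, let [v_d] be the net of
    finite rank operators on [Y].  The coordinates of [v_d \o F] are quasilinear
    functionals on the K-space [X], hence bounded perturbations of linear ones,
    so that [v_d \o F] is a linear map plus a bounded quasilinear map of constant
    at most [M * Q(F)].  The bounded part is close to a linear map,
    and [v_d (F x) --> F x], so that gluing applies with [G d = v_d \o F]. *)

Set Implicit Arguments.
Unset Strict Implicit.
Unset Printing Implicit Defensive.
Import Order.TTheory GRing.Theory Num.Theory.
Import numFieldNormedType.Exports.

Local Open Scope classical_set_scope.
Local Open Scope ring_scope.

Local Notation scalar := Defs.scalar.

(** * Completeness of the scalars *)

Section scalars.
Variables (R : realType) (k : scalar_kind).

Lemma modulus_surj (r : R) : 0 <= r -> exists a : scalar R k, modulus a = r.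
Proof.
case: k => r0; first by exists r => /=; rewrite ger0_norm.
by exists (r%:C)%C => /=; rewrite expr0n /= addr0 sqrtr_sqr ger0_norm.
Qed.

Lemma cauchy_real_lim (a r : R^nat) : r @ \oo --> 0 ->
  (forall n l, `|a n - a l| <= r n + r l) ->
  exists b, `|a n - b| @[n --> \oo] --> 0.
Proof.
move=> r0 ar.
have /cvg_ex[b ab] : cvgn a.
  apply/cauchy_cvgP/cauchy_exP => e e0.
  have e20 : 0 < e / 2 by rewrite divr_gt0.
  have /cvgrPdist_lt /(_ _ e20) [N _ hN] := r0.
  exists (a N); exists N => // n /= Nn; rewrite /ball /=.
  apply: (le_lt_trans (ar _ _)); rewrite [ltRHS]splitr ltrD //.
    have := hN N (leqnn _); rewrite /= sub0r normrN.
    by apply: le_lt_trans (ler_norm _).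
  have := hN n Nn; rewrite /= sub0r normrN.
  by apply: le_lt_trans (ler_norm _).
exists b; rewrite -[X in _ --> X](@normr0 _ R) -(subrr b).
by apply: cvg_norm; apply: cvgB => //; exact: cvg_cst.
Qed.

(** The bound [r n + r l] is the form in which Cauchy estimates come from the
    quasi-triangle inequality; complex sequences reduce to their real and
    imaginary parts. *)
Lemma cauchy_scalar_lim (a : nat -> scalar R k) (r : R^nat) : r @ \oo --> 0 ->
  (forall n l, modulus (a n - a l) <= r n + r l) ->
  exists b, modulus (a n - b) @[n --> \oo] --> 0.
Proof.
move=> r0; case: k a => /= a ar; first exact: (cauchy_real_lim r0 ar).
have leRe (z : R[i]) : `|complex.Re z| <= Normc.normc z.
  case: z => x y /=; rewrite -[leLHS]sqrtr_sqr ler_wsqrtr //.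
  by rewrite lerDl sqr_ge0.
have leIm (z : R[i]) : `|complex.Im z| <= Normc.normc z.
  case: z => x y /=; rewrite -[leLHS]sqrtr_sqr ler_wsqrtr //.
  by rewrite lerDr sqr_ge0.
have le_normc (z : R[i]) :
    Normc.normc z <= `|complex.Re z| + `|complex.Im z|.
  case: z => x y /=; rewrite -[leRHS]ger0_norm ?addr_ge0 //.
  rewrite -sqrtr_sqr ler_wsqrtr // sqrrD !real_normK ?num_real //.
  by rewrite addrAC lerDl mulrn_wge0 // mulr_ge0.
have [x ax] : exists x, `|complex.Re (a n) - x| @[n --> \oo] --> (0 : R).
  apply: (cauchy_real_lim r0) => n l; apply: le_trans (ar n l).
  by apply: le_trans (leRe _); case: (a n) (a l) => [? ?] [? ?].
have [y ay] : exists y, `|complex.Im (a n) - y| @[n --> \oo] --> (0 : R).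
  apply: (cauchy_real_lim r0) => n l; apply: le_trans (ar n l).
  by apply: le_trans (leIm _); case: (a n) (a l) => [? ?] [? ?].
exists (x +i* y)%C.
apply: (@squeeze_cvgr _ _ _ _ (fun=> 0)
  (fun n => `|complex.Re (a n) - x| + `|complex.Im (a n) - y|)).
- apply: nearW => n; apply/andP; split; first exact: (@modulus_ge0 R ComplexScalars).
  by apply: le_trans (le_normc _) _; case: (a n).
- exact: cvg_cst.
- by rewrite -[X in _ --> X]addr0; exact: cvgD.
Qed.

End scalars.

(** * Finite families of vectors *)

Section finite_families.
Variables (R : realType) (k : scalar_kind) (V : quasiNormedType R k).
Implicit Types (e f : nat -> V) (x y : V) (m n : nat) (a : nat -> scalar R k).

Lemma qnormB_ex1 : exists2 D : R, 1 <= D &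
  (forall x y, qnorm (x + y) <= D * (qnorm x + qnorm y)) /\
  (forall x y, qnorm (x - y) <= D * (qnorm x + qnorm y)).
Proof.
have [D D1 hD] := qnormD_ex1 V; exists D => //; split=> // x y.
by rewrite -(qnormN y); exact: hD.
Qed.

Lemma qnorm_sum_ex m : exists2 N : R, 0 <= N &
  forall e, qnorm (\sum_(i < m) e i) <= N * \sum_(i < m) qnorm (e i).
Proof.
have [D D1 hD] := qnormD_ex1 V; have D0 := le_trans ler01 D1.
elim: m => [|m [N N0 hN]].
  by exists 0 => // e; rewrite !big_ord0 qnorm0 mulr0.
exists (D * (N + 1)) => [|e]; first by rewrite mulr_ge0 ?addr_ge0.
rewrite !big_ord_recr /=; apply: (le_trans (hD _ _)).
have s0 : 0 <= \sum_(i < m) qnorm (e i) by apply: sumr_ge0 => i _; exact: qnorm_ge0.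
rewrite -mulrA ler_wpM2l // mulrDr lerD //.
  by apply: (le_trans (hN e)); rewrite mulrDl lerDl mul1r.
by rewrite mulrDl mul1r lerDr mulr_ge0 ?qnorm_ge0.
Qed.

Lemma qnorm_comb_ex m f : exists2 N : R, 0 <= N &
  forall a, qnorm (\sum_(i < m) a i *: f i) <= N * \sum_(i < m) modulus (a i).
Proof.
have [N N0 hN] := qnorm_sum_ex m.
pose S := \sum_(i < m) qnorm (f i).
have S0 : 0 <= S by apply: sumr_ge0 => i _; exact: qnorm_ge0.
exists (N * S) => [|a]; first by rewrite mulr_ge0.
apply: (le_trans (hN (fun i => a i *: f i))).
rewrite -mulrA ler_wpM2l // mulr_sumr ler_sum // => i _.
rewrite qnormZ mulrC ler_wpM2r ?modulus_ge0 // /S (bigD1 i) //= lerDl.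
by apply: sumr_ge0 => j _; exact: qnorm_ge0.
Qed.

(** Families are indexed by [nat] and cut off at [m], so that one vector is
    appended without any transport between ordinal types. *)
Definition indep e m := forall a,
  \sum_(i < m) a i *: e i = 0 -> forall i, (i < m)%N -> a i = 0.

Definition inspan e m x := exists a, x = \sum_(i < m) a i *: e i.

Lemma inspan_comb e m n f a : (forall i, (i < n)%N -> inspan e m (f i)) ->
  inspan e m (\sum_(i < n) a i *: f i).
Proof.
elim: n => [|n IH] fs.
  exists (fun=> 0); rewrite big_ord0 big1 // => i _; exact: scale0r.
have [|b hb] := IH; first by move=> i ni; apply: fs; exact: ltnW.
have [c hc] := fs n (leqnn _).
exists (fun i => b i + a n * c i); rewrite big_ord_recr /= hb hc scaler_sumr.
by rewrite -big_split; apply: eq_bigr => i _; rewrite scalerDl scalerA.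
Qed.

Lemma inspan_mem e m i : (i < m)%N -> inspan e m (e i).
Proof.
move=> im; exists (fun j => (j == i)%:R); rewrite (bigD1 (Ordinal im)) //=.
rewrite eqxx scale1r big1 ?addr0 // => j /negPf ji.
by rewrite -[(j : nat) == i]/(j == Ordinal im) ji scale0r.
Qed.

Lemma indep_ltn e m : indep e m.+1 -> indep e m.
Proof.
move=> ind a a0 i im.
have := ind (fun j => if (j < m)%N then a j else 0); rewrite big_ord_recr /=.
rewrite ltnn scale0r addr0.
under eq_bigr => j _ do rewrite ltn_ord.
by move=> /(_ a0 i (ltnW im)); rewrite im.
Qed.

(** Vectors are added one at a time: a new one either lies in the span already
    obtained or extends the independent family. *)
Lemma exists_indep n f : exists m e,
  indep e m /\ forall i, (i < n)%N -> inspan e m (f i).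
Proof.
elim: n => [|n [m [e [ind sp]]]]; first by exists 0%N, f.
have [fn|fn] := pselect (inspan e m (f n)).
  by exists m, e; split=> // i; rewrite ltnS leq_eqVlt => /orP[/eqP ->//|/sp].
pose e' i := if (i < m)%N then e i else f n.
have ee' a : \sum_(i < m) a i *: e' i = \sum_(i < m) a i *: e i.
  by apply: eq_bigr => i _; rewrite /e' ltn_ord.
exists m.+1, e'; split=> [a|i].
  rewrite big_ord_recr /= ee' /e' ltnn => a0.
  have am : a m = 0.
    apply/eqP/negP => /negP am; apply: fn; exists (fun i => - (a m)^-1 * a i).
    move/eqP: a0; rewrite addrC addr_eq0 => /eqP /(congr1 (fun x => (a m)^-1 *: x)).
    rewrite scalerA mulVf // scale1r => ->; rewrite scalerN scaler_sumr -sumrN.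
    by apply: eq_bigr => i _; rewrite scalerA mulNr scaleNr.
  move: a0; rewrite am scale0r addr0 => /ind a0 i.
  by rewrite ltnS leq_eqVlt => /orP[/eqP ->//|/a0].
rewrite ltnS leq_eqVlt => /orP[/eqP ->|/sp [a ->]].
  by have := inspan_mem e' (ltnSn m); rewrite /e' ltnn.
rewrite -ee'; apply: inspan_comb => j jm; apply: inspan_mem; exact: ltnW.
Qed.

End finite_families.

(** * Coordinates in finite-dimensional subspaces *)

Section coordinates.
Variables (R : realType) (k : scalar_kind) (V : quasiNormedType R k).
Implicit Types (e f : nat -> V) (x y : V) (m n : nat) (a : nat -> scalar R k).

(** Equivalence of quasi-norms in finite dimension.  A quasi-norm can be
    discontinuous, so the proof is by induction on the dimension rather than by
    minimizing over a compact sphere: if the last coordinate were not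
    controlled, [- e m] would be a limit of combinations of the previous
    vectors; the coordinates of these form Cauchy sequences by induction, and
    their limits would express [- e m] as such a combination. *)
Lemma indep_coord_le e m : indep e m -> exists2 N : R, 0 <= N &
  forall a, \sum_(i < m) modulus (a i) <= N * qnorm (\sum_(i < m) a i *: e i).
Proof.
have [D D1 [hD hB]] := qnormB_ex1 V; have D0 := le_trans ler01 D1.
elim: m => [|m IH] ind.
  by exists 0 => // a; rewrite !big_ord0 mul0r.
have [N N0 hN] := IH (indep_ltn ind).
have [S S0 hS] := qnorm_comb_ex m e.
suff [P P0 hP] : exists2 P : R, 0 <= P & forall a,
    modulus (a m) <= P * qnorm (\sum_(i < m.+1) a i *: e i).
  exists (N * (D * (1 + P * qnorm (e m))) + P) => [|a].
    by rewrite addr_ge0 ?mulr_ge0 ?addr_ge0 ?mulr_ge0 ?qnorm_ge0.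
  have {hP} := hP a; rewrite !big_ord_recr /=.
  set s := \sum_(i < m) a i *: e i => aP.
  rewrite mulrDl lerD //; apply: (le_trans (hN a)).
  rewrite -!mulrA ler_wpM2l //.
  have -> : \sum_(i < m) a i *: e i = s + a m *: e m - a m *: e m by rewrite addrK.
  apply: (le_trans (hB _ _)); rewrite ler_wpM2l // mulrDl mul1r lerD2l qnormZ.
  by rewrite mulrAC ler_wpM2r ?qnorm_ge0.
apply: contrapT => nP.
(* Coefficients divided by that of [e m], for a combination violating the
   bound with constant [n.+1]. *)
have {nP} hb n : exists b : nat -> scalar R k,
    qnorm (\sum_(i < m) b i *: e i + e m) <= n.+1%:R^-1.
  apply: contrapT => nb; apply: nP; exists n.+1%:R => [//|a].
  rewrite leNgt; apply/negP => na; apply: nb.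
  have am0 : 0 < modulus (a m).
    by apply: le_lt_trans na; rewrite mulr_ge0 ?qnorm_ge0.
  have am : a m != 0 by apply: contraTneq am0 => ->; rewrite modulus0 ltxx.
  exists (fun i => (a m)^-1 * a i).
  have -> : \sum_(i < m) ((a m)^-1 * a i) *: e i + e m =
            (a m)^-1 *: \sum_(i < m.+1) a i *: e i.
    rewrite big_ord_recr /= scalerDr scalerA mulVf // scale1r scaler_sumr.
    by congr (_ + _); apply: eq_bigr => i _; rewrite scalerA.
  rewrite qnormZ modulusV ler_pdivrMl // -ler_pdivrMr ?invr_gt0 // invrK mulrC.
  exact: ltW.
have {hb} [b hb] := choice hb.
pose r n : R := N * D / n.+1%:R.
have h0 : (n.+1%:R^-1 : R) @[n --> \oo] --> 0.
  exact: (@cvg_harmonic R).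
have r0 : r @ \oo --> 0.
  by rewrite -(mulr0 (N * D)); apply: cvgM => //; exact: cvg_cst.
have hcau i : (i < m)%N -> exists c, modulus (b n i - c) @[n --> \oo] --> (0 : R).
  move=> im; apply: (cauchy_scalar_lim r0) => n l.
  apply: (@le_trans _ _ (\sum_(j < m) modulus (b n j - b l j))).
    rewrite (bigD1 (Ordinal im)) //= lerDl.
    by apply: sumr_ge0 => j _; exact: modulus_ge0.
  apply: (le_trans (hN (fun j => b n j - b l j))).
  rewrite /r -!mulrA -mulrDr ler_wpM2l // -mulrDr.
  have -> : \sum_(i0 < m) (b n i0 - b l i0) *: e i0 =
     (\sum_(i < m) b n i *: e i + e m) - (\sum_(i < m) b l i *: e i + e m).
    rewrite opprD addrACA subrr addr0 -sumrB.
    by apply: eq_bigr => j _; rewrite scalerBl.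
  apply: (le_trans (hB _ _)); rewrite ler_wpM2l //.
  by rewrite lerD.
have {hcau} /choice[c hc] : forall i, exists c, (i < m)%N ->
    modulus (b n i - c) @[n --> \oo] --> (0 : R).
  move=> i; have [im|im] := boolP (i < m)%N; last by exists 0.
  by have [c ?] := hcau i im; exists c.
suff : qnorm (\sum_(i < m) c i *: e i + e m) = 0.
  move=> /qnorm_eq0 ce; have := ind (fun i => if (i < m)%N then c i else 1).
  rewrite big_ord_recr /= ltnn scale1r.
  under eq_bigr => j _ do rewrite ltn_ord.
  by move=> /(_ ce m (ltnSn m)); rewrite ltnn => /eqP; rewrite oner_eq0.
apply/eqP; rewrite eq_le qnorm_ge0 andbT.
pose t n := D * (n.+1%:R^-1 + S * \sum_(i < m) modulus (b n i - c i)).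
have t0 : t @ \oo --> 0.
  rewrite -(mulr0 D); apply: cvgM; first exact: cvg_cst.
  rewrite -[X in _ --> X](addr0 0); apply: cvgD => //.
  rewrite -[X in _ --> X](mulr0 S); apply: cvgM; first exact: cvg_cst.
  rewrite [X in _ --> X](_ : _ = \sum_(i < m) 0); last by rewrite big1.
  by apply: (cvg_big add_continuous) => i _; exact: hc.
have : qnorm (\sum_(i < m) c i *: e i + e m) @[n --> \oo] -->
       qnorm (\sum_(i < m) c i *: e i + e m) by exact: cvg_cst.
move=> s_cvg; apply: (ler_cvg_to s_cvg t0); apply: nearW => n.
have -> : \sum_(i < m) c i *: e i + e m =
    (\sum_(i < m) b n i *: e i + e m) - \sum_(i < m) (b n i - c i) *: e i.
  rewrite addrAC; congr (_ + _); rewrite -sumrB; apply: eq_bigr => i _.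
  by rewrite -scalerBl subKr.
apply: (le_trans (hB _ _)); rewrite ler_wpM2l // lerD //.
exact: (hS (fun i => b n i - c i)).
Qed.

End coordinates.

(** * Boundedness and convergence in terms of quasi-norms *)

Section boundedness.
Variables (R : realType) (k : scalar_kind).

(** Nonnegativity of [M] is part of the equivalence because the unit ball
    contains 0, whereas the bounds alone allow any [M] if [V] is zero. *)
Lemma map_normP (V W : quasiNormedType R k) (F : V -> W) (M : R) :
  scalable F ->
  (map_norm F <= M%:E)%E <-> 0 <= M /\ forall x, qnorm (F x) <= M * qnorm x.
Proof.
move=> sF; split=> [FM|[M0 hM]]; last first.
  apply: ge_ereal_sup => _ [x /= x1 <-]; rewrite lee_fin.
  by apply: (le_trans (hM x)); rewrite -[leRHS]mulr1 ler_wpM2l.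
have F0 : F 0 = 0 by rewrite -(scale0r 0) sF scale0r.
have hM x : qnorm x <= 1 -> qnorm (F x) <= M.
  move=> x1; rewrite -lee_fin; apply: le_trans FM.
  by apply: ereal_sup_ubound; exists x.
have M0 : 0 <= M by have := hM 0; rewrite F0 !qnorm0 => /(_ ler01).
split=> // x; have [/qnorm_eq0 ->|x0] := eqVneq (qnorm x) 0.
  by rewrite F0 !qnorm0 mulr0.
have xp : 0 < qnorm x by rewrite lt_def x0 qnorm_ge0.
have [a ha] : exists a : scalar R k, modulus a = (qnorm x)^-1.
  by apply: modulus_surj; rewrite invr_ge0 ltW.
have := hM (a *: x); rewrite sF !qnormZ ha mulVf // lexx => /(_ isT).
by rewrite ler_pdivrMl // mulrC.
Qed.

Lemma bounded_mapP (V W : quasiNormedType R k) (F : V -> W) : scalable F ->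
  bounded_map F <-> exists M : R, forall x, qnorm (F x) <= M * qnorm x.
Proof.
move=> sF; rewrite /bounded_map; split=> [b|[M hM]].
  have b0 : (0 <= map_norm F)%E.
    apply: ereal_sup_ubound; exists 0; first by rewrite /= qnorm0.
    by rewrite -(scale0r 0) sF scale0r qnorm0.
  have /(map_normP _ sF)[_ hM] : (map_norm F <= (fine (map_norm F))%:E)%E.
    by rewrite fineK // ge0_fin_numE.
  by exists (fine (map_norm F)).
apply: (@le_lt_trans _ _ (Num.max M 0)%:E); last exact: ltry.
apply/(map_normP _ sF); split=> [|x]; first by rewrite le_max lexx orbT.
by apply: (le_trans (hM x)); rewrite ler_wpM2r ?qnorm_ge0 // le_max lexx.
Qed.

Lemma nbhs_qnormP (V : quasiNormedType R k) (x : V) (A : set V) :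
  nbhs x A <-> exists2 e : R, 0 < e & forall y, qnorm (x - y) < e -> A y.
Proof.
rewrite -nbhs_entourageE; split.
  case=> B; rewrite entourage_qnorm => -[e /= e0 sB] BA; exists e => // y xy.
  by apply: BA; apply/xsectionP; exact: sB.
case=> e e0 eA; exists [set xy | qnorm (xy.1 - xy.2) < e].
  by rewrite entourage_qnorm; exists e.
by move=> y /xsectionP; exact: eA.
Qed.

Lemma cvg_qnormP (V : quasiNormedType R k) (T : Type) (U : set_system T)
    (f : T -> V) (x : V) :
  f i @[i --> U] --> x ->
  forall e : R, 0 < e -> \forall i \near U, qnorm (f i - x) < e.
Proof.
move=> fx e e0; have /fx : nbhs x [set y | qnorm (y - x) < e].
  by apply/nbhs_qnormP; exists e => // y; rewrite -qnormN opprB.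
exact.
Qed.

Lemma linear_continuous_bounded (V W : quasiNormedType R k)
    (p : {linear V -> W}) : continuous p ->
  exists2 M : R, 0 <= M & forall x, qnorm (p x) <= M * qnorm x.
Proof.
move=> cp.
have /(cp 0)/nbhs_qnormP[e e0 he] : nbhs (p 0) [set y | qnorm y < 1].
  by apply/nbhs_qnormP; exists 1 => // y; rewrite linear0 sub0r qnormN.
have [a ha] := modulus_surj k (ltW (divr_gt0 e0 (ltr0Sn R 1))).
have a0 : a != 0.
  apply: contra_eqN ha => /eqP ->; rewrite modulus0 eq_sym mulf_neq0 ?invr_eq0 //.
  by rewrite gt_eqF.
have sp : scalable p by exact: linearZ_LR.
suff : (map_norm p <= (modulus a)^-1%:E)%E.
  by move=> /(map_normP _ sp)[? ?]; exists (modulus a)^-1.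
apply: ge_ereal_sup => _ [x /= x1 <-]; rewrite lee_fin.
have : qnorm (p (a *: x)) < 1.
  apply: he; rewrite sub0r qnormN qnormZ ha.
  apply: (@le_lt_trans _ _ (e / 2 * 1)).
    by rewrite ler_wpM2l // divr_ge0 // ltW.
  by rewrite mulr1 ltr_pdivrMr // ltr_pMr // ltr1n.
rewrite linearZ qnormZ => /ltW h.
by rewrite -[leRHS]mulr1 ler_pdivlMl // ha divr_gt0.
Qed.

End boundedness.

(** * Quasilinear maps and finite rank operators *)

Section quasilinear_maps.
Variables (R : realType) (k : scalar_kind).
Implicit Types (V W : quasiNormedType R k) (Q : R).

(** The maps obtained below are linear only after a choice of coordinates or of
    representatives; this puts them in the form that the definitions of the
    constants require. *)
Lemma linear_bundle V W (f : V -> W) : linear f ->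
  exists L : {linear V -> W}, forall x, L x = f x.
Proof.
move=> lf.
pose L : {linear V -> W} := HB.pack f (GRing.isLinear.Build _ _ _ _ f lf).
by exists L.
Qed.

Lemma scalable_fun0 V W (F : V -> W) : scalable F -> F 0 = 0.
Proof. by move=> sF; rewrite -(scale0r 0) sF scale0r. Qed.

Lemma scalableB_linear V W (F : V -> W) (L : {linear V -> W}) :
  scalable F -> scalable (F \- L).
Proof. by move=> sF a x /=; rewrite sF linearZ scalerBr. Qed.

Lemma quasilinear_const_attained V W (F : V -> W) :
  quasilinear F -> quasilinear_constants F (quasilinear_const F).
Proof.
move=> [_ qF]; split; first by apply: lb_le_inf => // Q [].
move=> x y; have [Q0 [_ hQ0]] := qF.
have s0 : 0 <= qnorm x + qnorm y by rewrite addr_ge0 ?qnorm_ge0.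
have [s|s] := eqVneq (qnorm x + qnorm y) 0.
  by rewrite (le_trans (hQ0 x y)) // s !mulr0.
have sp : 0 < qnorm x + qnorm y by rewrite lt_def s.
rewrite -ler_pdivrMr //; apply: lb_le_inf => // Q [_ hQ].
by rewrite ler_pdivrMr.
Qed.

Lemma quasilinear_const_le V W (F : V -> W) Q :
  quasilinear_constants F Q -> quasilinear_const F <= Q.
Proof. by move=> FQ; apply: ge_inf => //; exists 0 => q []. Qed.

Lemma K0_const_ltyP V W : (K0_const V W < +oo)%E ->
  exists2 C : R, 0 <= C & forall (F : V -> W) Q,
    scalable F -> quasilinear_constants F Q -> bounded_map F ->
    exists L : {linear V -> W}, forall x, qnorm (F x - L x) <= C * Q * qnorm x.
Proof.
move=> /ereal_inf_ltP[_ [C [C0 hC] <-] _]; exists C => // F Q sF FQ bF.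
have qF : quasilinear F by split=> //; exists Q.
have [L /(map_normP _ (scalableB_linear L sF))[_ hL]] := hC F qF bF.
exists L => x; apply: (le_trans (hL x)).
by rewrite ler_wpM2r ?qnorm_ge0 // ler_wpM2l //; exact: quasilinear_const_le.
Qed.

Lemma K_const_ltyP V W : (K_const V W < +oo)%E <->
  exists2 C : R, 0 <= C & forall (F : V -> W) Q,
    scalable F -> quasilinear_constants F Q ->
    exists L : {linear V -> W}, forall x, qnorm (F x - L x) <= C * Q * qnorm x.
Proof.
split.
  move=> /ereal_inf_ltP[_ [C [C0 hC] <-] _]; exists C => // F Q sF FQ.
  have qF : quasilinear F by split=> //; exists Q.
  have [L /(map_normP _ (scalableB_linear L sF))[_ hL]] := hC F qF.
  exists L => x; apply: (le_trans (hL x)).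
  by rewrite ler_wpM2r ?qnorm_ge0 // ler_wpM2l //; exact: quasilinear_const_le.
move=> [C C0 hC]; apply/ereal_inf_ltP; exists C%:E; last exact: ltry.
exists C => //; split=> // F qF; have [sF _] := qF.
have FQ := quasilinear_const_attained qF.
have [L hL] := hC F _ sF FQ; exists L.
apply/(map_normP _ (scalableB_linear L sF)); split=> //.
by case: FQ => ? _; rewrite mulr_ge0.
Qed.

(** The constant [N] depends on the number of summands only, not on [F]: this is
    what lets the approximation error be absorbed uniformly in [F]. *)
Lemma quasilinear_sum_ex V W m : exists2 N : R, 0 <= N &
  forall (F : V -> W) Q, scalable F -> quasilinear_constants F Q ->
  forall x : nat -> V, qnorm (F (\sum_(i < m) x i) - \sum_(i < m) F (x i)) <=
                       N * Q * \sum_(i < m) qnorm (x i).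
Proof.
have [D D1 hD] := qnormD_ex1 W; have D0 := le_trans ler01 D1.
elim: m => [|m [N N0 hN]].
  exists 0 => // F Q sF _ x.
  by rewrite !big_ord0 scalable_fun0 // subrr qnorm0 !mul0r.
have [S S0 hS] := qnorm_sum_ex V m.
exists (D * (S + 1 + N)) => [|F Q sF FQ x]; first by rewrite mulr_ge0 ?addr_ge0.
have [Q0 hQ] := FQ; rewrite !big_ord_recr /=.
have {hN} := hN F Q sF FQ x; have {hS} := hS x.
set s := \sum_(i < m) x i; set t := \sum_(i < m) F (x i).
set q := \sum_(i < m) qnorm (x i) => hS hN.
have q0 : 0 <= q by apply: sumr_ge0 => i _; exact: qnorm_ge0.
(* The error splits into that of the last addition and that of [m] terms. *)
have -> : F (s + x m) - (t + F (x m)) = (F (s + x m) - F s - F (x m)) + (F s - t).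
  by rewrite [in RHS](addrAC _ (- F s)) subrKA opprD [- t - _]addrC addrA.
apply: (le_trans (hD _ _)); rewrite -!mulrA ler_wpM2l //.
have -> : (S + 1 + N) * (Q * (q + qnorm (x m))) =
    Q * (S * q + qnorm (x m) + (q + S * qnorm (x m))) + N * Q * (q + qnorm (x m)).
  by ring.
apply: lerD; last first.
  by apply: (le_trans hN); rewrite ler_wpM2l ?mulr_ge0 // lerDl qnorm_ge0.
apply: (le_trans (hQ _ _)); rewrite ler_wpM2l // -[leLHS]addr0 lerD //.
  by rewrite lerD2r.
by rewrite addr_ge0 // mulr_ge0 ?qnorm_ge0.
Qed.

(** The vectors given with a finite rank operator may be dependent, which leaves
    the coefficients of [u x] undetermined.  Over an independent family they are
    unique, hence linear in [x], and bounded by [indep_coord_le]. *)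
Lemma finite_rank_coords V W (u : {linear V -> W}) (M : R) :
  (forall x, qnorm (u x) <= M * qnorm x) -> finite_rank u ->
  exists (m : nat) (e : nat -> W) (c : nat -> {linear V -> (scalar R k)^o}) (N : R),
    [/\ 0 <= N, forall x, u x = \sum_(i < m) (c i x : scalar R k) *: e i &
        forall i x, qnorm (c i x) <= N * qnorm x].
Proof.
move=> uM [n [f hf]].
pose f' i := if insub i is Some j then f j else 0.
have f'E (i : 'I_n) : f' i = f i by rewrite /f' valK.
have [m [e [ind sp]]] := exists_indep n f'.
have [N N0 hN] := indep_coord_le ind.
have /choice[c hc] x : exists a : nat -> scalar R k, u x = \sum_(i < m) a i *: e i.
  have [d ->] := hf x; pose d' i := if insub i is Some j then d j else 0.
  have -> : \sum_i d i *: f i = \sum_(i < n) d' i *: f' i.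
    by apply: eq_bigr => i _; rewrite f'E /d' valK.
  exact: (inspan_comb d' sp).
have lc i : linear (fun x => (if (i < m)%N then c x i else 0) : (scalar R k)^o).
  move=> a x y; case: ifPn => im; last by rewrite scaler0 addr0.
  apply/eqP; rewrite -subr_eq0; apply/eqP.
  apply: (ind (fun i =>
    c (a *: x + y) i - (a *: (c x i : (scalar R k)^o) + c y i))) im.
  under eq_bigr => j _ do rewrite scalerBl scalerDl -scalerA.
  by rewrite sumrB big_split /= -scaler_sumr -!hc linearP subrr.
have /choice[c' hc'] i := linear_bundle (lc i).
have NM0 : 0 <= N * Num.max M 0 by rewrite mulr_ge0 // le_max lexx orbT.
exists m, e, c', (N * Num.max M 0); split=> // [x|i x].
  by rewrite hc; apply: eq_bigr => i _; rewrite hc' ltn_ord.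
rewrite hc'; case: ifPn => im; last by rewrite qnorm0 mulr_ge0 ?qnorm_ge0.
apply: (@le_trans _ _ (\sum_(j < m) modulus (c x j))).
  rewrite (bigD1 (Ordinal im)) //= lerDl.
  by apply: sumr_ge0 => j _; exact: modulus_ge0.
apply: (le_trans (hN _)); rewrite -hc -mulrA ler_wpM2l //.
by apply: (le_trans (uM x)); rewrite ler_wpM2r ?qnorm_ge0 // le_max lexx.
Qed.

End quasilinear_maps.

(** * Linear maps with values in an ultrasummand *)

Section ultrapower_lifting.
Variables (R : realType) (k : scalar_kind).

Lemma uclass_near (Y : quasiNormedType R k) (I : Type) (U : set_system I)
    (FU : UltraFilter U) (y z : linfty I Y) :
  (forall e : R, 0 < e -> \forall i \near U, qnorm (y i - z i) < e) ->
  uclass FU y = uclass FU z.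
Proof.
move=> yz; apply/uclass_eqP/cvgrPdist_lt => e /yz.
by apply: filterS => i; rewrite sub0r normrN ger0_norm // qnorm_ge0.
Qed.

(** [L x] is the projection of the class of the family [l i x].  That family may
    be unbounded away from a set of the ultrafilter, and is replaced by 0 there
    (where [good x i] fails) without changing its behaviour along [U]. *)
Lemma ultrasummand_lift (Y : quasiBanachType R k) (I : Type)
    (U : set_system I) (FU : UltraFilter U) : ultrasummand Y ->
  exists2 P : R, 0 <= P &
  forall (X : quasiNormedType R k) (F : X -> Y) (G l : I -> X -> Y) (B : R),
  0 <= B ->
  (forall x (e : R), 0 < e -> \forall i \near U, qnorm (G i x - F x) < e) ->
  (forall x, \forall i \near U, qnorm (G i x - l i x) <= B * qnorm x) ->
  (forall a x y, \forall i \near U, l i (a *: x + y) = a *: l i x + l i y) ->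
  exists L : {linear X -> Y}, forall x, qnorm (F x - L x) <= P * B * qnorm x.
Proof.
move=> usY; have [p [/linear_continuous_bounded[P P0 hP] pK]] := usY I U FU.
exists P => // X F G l B B0 GF Gl lin.
have [D D1 [hD hB]] := qnormB_ex1 Y; have D0 := le_trans ler01 D1.
pose good x i := `[< qnorm (G i x - l i x) <= B * qnorm x /\
                     qnorm (G i x - F x) <= 1 >].
have good_near x : \forall i \near U, good x i.
  near=> i; apply/asboolP; split; first by near: i; exact: Gl.
  by apply: ltW; near: i; exact: GF.
have bl x : (fun i => if good x i then l i x else 0) \in @bounded_family R k I Y.
  apply/bounded_familyP.
  exists (D * (D * (B * qnorm x + 1) + qnorm (F x))) => i.
  rewrite /good; case: asboolP => [[h1 h2]|_]; last first.
    by rewrite qnorm0 !(mulr_ge0, addr_ge0, qnorm_ge0).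
  rewrite -[l i x](subrK (F x)); apply: (le_trans (hD _ _)).
  rewrite ler_wpM2l // lerD2r.
  have -> : l i x - F x = (G i x - F x) - (G i x - l i x).
    by rewrite opprB [RHS]addrC subrKA.
  by apply: (le_trans (hB _ _)); rewrite ler_wpM2l // addrC lerD.
have bw x : (fun i => if good x i then l i x - G i x else 0)
    \in @bounded_family R k I Y.
  apply/bounded_familyP; exists (B * qnorm x) => i.
  rewrite /good; case: asboolP => [[h1 h2]|_]; last first.
    by rewrite qnorm0 mulr_ge0 ?qnorm_ge0.
  by rewrite -opprB qnormN.
pose y x := Linfty (bl x); pose w x := Linfty (bw x).
(* The family [w x] represents the difference between the class of [y x] and
   the diagonal image of [F x], with the right bound at every index. *)
have linL : linear (fun x => p (uclass FU (y x))).
  move=> a x x'; rewrite -linearP -uclass_linear; congr (p _).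
  apply: uclass_near => e e0.
  near=> i.
  change (qnorm (y (a *: x + x') i - (a *: y x i + y x' i)) < e).
  rewrite /y /=.
  have -> : good (a *: x + x') i by near: i; exact: good_near.
  have -> : good x i by near: i; exact: good_near.
  have -> : good x' i by near: i; exact: good_near.
  have -> : l i (a *: x + x') = a *: l i x + l i x' by near: i; exact: lin.
  by rewrite subrr qnorm0.
have [L hL] := linear_bundle linL; exists L => x.
rewrite -qnormN opprB hL -{1}(pK (F x)) addrC -linearN -linearD.
have -> : - diagonal_embedding FU (F x) + uclass FU (y x) = uclass FU (w x).
  rewrite -scaleN1r -uclass_linear; apply: uclass_near => e e0.
  near=> i.
  change (qnorm (-1 *: F x + y x i - w x i) < e).
  have gi : good x i by near: i; exact: good_near.
  rewrite /y /w /= gi scaleN1r opprB [X in qnorm X]addrC [- F x + _]addrC subrKA.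
  by near: i; exact: GF.
apply: (le_trans (hP _)); rewrite -mulrA ler_wpM2l //.
apply: (le_trans (ultrapower_norm_le _ _)).
apply: linfty_norm_le => [|i]; first by rewrite mulr_ge0 ?qnorm_ge0.
rewrite /w /= /good; case: asboolP => [[h1 h2]|_]; last first.
  by rewrite qnorm0 mulr_ge0 ?qnorm_ge0.
by rewrite -opprB qnormN.
Unshelve. all: by end_near. Qed.

End ultrapower_lifting.

(** * From bounded to arbitrary quasilinear maps *)

Section approximation.
Variables (R : realType) (k : scalar_kind).
Implicit Types (V W : quasiNormedType R k) (Q : R).

Lemma quasilinear_comb_ex V W (F : V -> W) Q m (e : nat -> V) :
  scalable F -> quasilinear_constants F Q -> exists2 N : R, 0 <= N &
  forall a : nat -> scalar R k,
    qnorm (F (\sum_(i < m) a i *: e i)) <= N * \sum_(i < m) modulus (a i).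
Proof.
move=> sF FQ; have [Q0 _] := FQ.
have [D D1 hD] := qnormD_ex1 W; have D0 := le_trans ler01 D1.
have [N N0 hN] := quasilinear_sum_ex V W m.
have [P P0 hP] := qnorm_comb_ex m (F \o e).
pose S := \sum_(i < m) qnorm (e i).
have S0 : 0 <= S by apply: sumr_ge0 => i _; exact: qnorm_ge0.
exists (D * (N * Q * S + P)) => [|a]; first by rewrite !(mulr_ge0, addr_ge0).
rewrite -[F _](subrK (\sum_(i < m) a i *: F (e i))).
apply: (le_trans (hD _ _)); rewrite -mulrA ler_wpM2l // mulrDl lerD //.
have -> : \sum_(i < m) a i *: F (e i) = \sum_(i < m) F (a i *: e i).
  by apply: eq_bigr => i _; rewrite sF.
apply: (le_trans (hN F Q sF FQ (fun i => a i *: e i))).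
rewrite -!mulrA !ler_wpM2l // mulr_sumr ler_sum // => i _.
rewrite qnormZ mulrC ler_wpM2r ?modulus_ge0 // /S (bigD1 i) //= lerDl.
by apply: sumr_ge0 => j _; exact: qnorm_ge0.
Qed.

(** Only finitely many values of [F] matter, those at a basis of the range of
    [u]. *)
Lemma bounded_comp_finite_rank V W (Z : quasiNormedType R k)
    (F : W -> Z) Q (u : {linear V -> W}) (M : R) :
  scalable F -> quasilinear_constants F Q ->
  (forall x, qnorm (u x) <= M * qnorm x) -> finite_rank u ->
  bounded_map (F \o u).
Proof.
move=> sF FQ uM fu.
have [m [e [c [N [N0 hu hN]]]]] := finite_rank_coords uM fu.
have [P P0 hP] := quasilinear_comb_ex m e sF FQ.
apply/bounded_mapP => [a x /=|]; first by rewrite linearZ sF.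
exists (P * (N *+ m)) => x /=; rewrite hu; apply: (le_trans (hP (fun i => c i x))).
rewrite -mulrA ler_wpM2l // mulrnAl -[X in _ *+ X]card_ord -sumr_const.
by apply: ler_sum => i _; exact: hN.
Qed.

Lemma quasilinear_constants_compr V W (Z : quasiNormedType R k)
    (F : W -> Z) Q (u : {linear V -> W}) (M : R) :
  0 <= M -> (forall x, qnorm (u x) <= M * qnorm x) ->
  quasilinear_constants F Q -> quasilinear_constants (F \o u) (Q * M).
Proof.
move=> M0 uM [Q0 hQ]; split; first by rewrite mulr_ge0.
move=> x y /=; rewrite linearD; apply: (le_trans (hQ _ _)).
by rewrite -mulrA ler_wpM2l // mulrDr lerD.
Qed.

Lemma quasilinear_constants_compl V W (Z : quasiNormedType R k)
    (F : V -> W) Q (u : {linear W -> Z}) (M : R) :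
  0 <= M -> (forall x, qnorm (u x) <= M * qnorm x) ->
  quasilinear_constants F Q -> quasilinear_constants (u \o F) (M * Q).
Proof.
move=> M0 uM [Q0 hQ]; split; first by rewrite mulr_ge0.
by move=> x y /=; rewrite -!linearB (le_trans (uM _)) // -mulrA ler_wpM2l.
Qed.

Lemma net_filter_proper (D : Type) (le : D -> D -> Prop) :
  directed le -> ProperFilter (net_filter le).
Proof.
move=> [[d0] rle tle dle]; apply: filter_from_proper; last first.
  by move=> d _; exists d; exact: rle.
apply: filter_from_filter; first by exists d0.
move=> d1 d2 _ _; have [d [d1d d2d]] := dle d1 d2; exists d => // e /= de.
by split; [exact: tle de|exact: tle de].
Qed.

Lemma bap_net (X : quasiBanachType R k) : bounded_approximation_property X ->
  exists (D : Type) (U : set_system D) (u : D -> {linear X -> X}) (M : R),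
  [/\ ProperFilter U, 0 <= M, forall d x, qnorm (u d x) <= M * qnorm x,
      forall d, finite_rank (u d) &
      forall x (e : R), 0 < e -> \forall d \near U, qnorm (u d x - x) < e].
Proof.
move=> [D [le [u [M [dir cu uM ux]]]]].
have su d : scalable (u d) by exact: linearZ_LR.
have PF := net_filter_proper dir.
exists D, (net_filter le), u, M; split=> // [|d x|d|x e e0].
- by have [[d] _ _ _] := dir; have /(map_normP _ (su d))[] := uM d.
- by have /(map_normP _ (su d))[] := uM d.
- by have [] := cu d.
- exact: cvg_qnormP (ux x) e e0.
Qed.

(** The case of one finite-dimensional subspace, in a form that makes no
    reference to it: [l] is linear as far as can be seen within the finite list
    [s].  The constant [B] does not depend on [s]. *)
Lemma bap_finite_linear_approx (X : quasiBanachType R k) W :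
  bounded_approximation_property X -> (K0_const X W < +oo)%E ->
  exists2 B : R, 0 <= B & forall (F : X -> W) Q,
  scalable F -> quasilinear_constants F Q -> forall s : seq X,
  exists l : X -> W,
    (forall a x y, x \in s -> y \in s -> a *: x + y \in s ->
       l (a *: x + y) = a *: l x + l y) /\
    forall x, x \in s -> qnorm (F x - l x) <= B * Q * qnorm x.
Proof.
move=> /bap_net[I [U [u [M [PU M0 uM fu ux]]]]] /K0_const_ltyP[C C0 hC].
have [D D1 [hD hB]] := qnormB_ex1 W; have D0 := le_trans ler01 D1.
exists (D * (D * (2 + 1) + C * M)) => [|F Q sF FQ s].
  by rewrite !(mulr_ge0, addr_ge0).
have [Q0 hQ] := FQ.
have [m [e [ind sp]]] := exists_indep (size s) (nth 0 s).
have [N N0 hN] := indep_coord_le ind.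
have [S S0 hS] := qnorm_sum_ex X m.
have [P P0 hP] := quasilinear_sum_ex X W m.
pose T := (S + P + 1) * (N + 1).
have T0 : 0 < T by rewrite mulr_gt0 // ltr_wpDl // addr_ge0.
have Ti0 : 0 < T^-1 by rewrite invr_gt0.
(* The index [d] is chosen after the basis, with [u d e_i - e_i] of quasi-norm
   less than [T^-1]; [T] is chosen to make [wT] below true. *)
have [d hd] : exists d, forall i : 'I_m, qnorm (u d (e i) - e i) < T^-1.
  have : \forall d \near U, forall i : 'I_m, qnorm (u d (e i) - e i) < T^-1.
    by apply: filter_forall => i; exact: ux.
  exact: filter_ex.
have [L hL] := hC (F \o u d) (Q * M)
  (fun a x => etrans (congr1 F (linearZ_LR (u d) a x)) (sF a (u d x)))
  (quasilinear_constants_compr M0 (uM d) FQ)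
  (bounded_comp_finite_rank sF FQ (uM d) (fu d)).
pose z i := u d (e i) - e i.
have /choice[c hc] x : exists a : nat -> scalar R k,
    inspan e m x -> x = \sum_(i < m) a i *: e i.
  by have [[a ?]|?] := pselect (inspan e m x); [exists a|exists (fun=> 0)].
have hcs x : x \in s -> x = \sum_(i < m) c x i *: e i.
  move=> xs; apply: hc; rewrite -(nth_index 0 xs); apply: sp.
  by rewrite index_mem.
exists (fun x => L x - \sum_(i < m) c x i *: F (z i)); split.
  move=> a x y xs ys xys; rewrite linearP scalerBr [RHS]addrACA; congr (_ + _).
  rewrite -opprD scaler_sumr -big_split; congr (- _).
  apply: eq_bigr => i _ /=; rewrite scalerA -scalerDl; congr (_ *: _).
  apply/eqP; rewrite -subr_eq0; apply/eqP.
  apply: (ind (fun i => c (a *: x + y) i - (a * c x i + c y i)) _ i (ltn_ord i)).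
  under eq_bigr => j _ do rewrite scalerBl scalerDl -scalerA.
  by rewrite sumrB big_split /= -scaler_sumr -!hcs // subrr.
move=> x xs.
have xN : \sum_(i < m) modulus (c x i) <= N * qnorm x by rewrite {2}(hcs x xs) hN.
pose w i := c x i *: z i.
have wE : \sum_(i < m) w i = u d x - x.
  rewrite [in RHS](hcs x xs) linear_sum -sumrB; apply: eq_bigr => i _.
  by rewrite /w /z linearZ scalerBr.
have wT : (S + P) * \sum_(i < m) qnorm (w i) <= qnorm x.
  apply: (@le_trans _ _ (T * (T^-1 * qnorm x))); last by rewrite mulVKf // gt_eqF.
  rewrite /T -mulrA; apply: ler_pM => //; first exact: addr_ge0.
  - by apply: sumr_ge0 => i _; exact: qnorm_ge0.
  - by rewrite lerDl.
  apply: (@le_trans _ _ (\sum_(i < m) T^-1 * modulus (c x i))).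
    apply: ler_sum => i _; rewrite qnormZ mulrC ler_wpM2r ?modulus_ge0 // ltW //.
    exact: hd.
  rewrite -mulr_sumr mulrCA ler_wpM2l ?(ltW Ti0) //; apply: (le_trans xN).
  by rewrite ler_wpM2r ?qnorm_ge0 // lerDl.
have w0 : 0 <= \sum_(i < m) qnorm (w i).
  by apply: sumr_ge0 => i _; exact: qnorm_ge0.
have uxx : qnorm (u d x - x) <= qnorm x.
  rewrite -wE; apply: (le_trans (hS w)); apply: le_trans wT.
  by rewrite ler_wpM2r // lerDl.
have h1 : qnorm (F (u d x) - F x - F (u d x - x)) <= Q * (qnorm x + qnorm x).
  have := hQ x (u d x - x); rewrite [x + _]addrC subrK => h; apply: (le_trans h).
  by rewrite ler_wpM2l // lerD2l.
have h2 : qnorm (F (u d x - x) - \sum_(i < m) c x i *: F (z i)) <= Q * qnorm x.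
  have -> : \sum_(i < m) c x i *: F (z i) = \sum_(i < m) F (w i).
    by apply: eq_bigr => i _; rewrite sF.
  rewrite -wE; apply: (le_trans (hP F Q sF FQ w)).
  rewrite (mulrC P) -mulrA ler_wpM2l //; apply: le_trans wT.
  by rewrite ler_wpM2r // lerDr.
(* The three differences are the error of [L], the error in the additivity of
   [F] at [x] and [u d x - x], and that in expanding [F (u d x - x)]. *)
have -> : F x - (L x - \sum_(i < m) c x i *: F (z i)) =
    (F (u d x) - L x) - ((F (u d x) - F x - F (u d x - x)) +
      (F (u d x - x) - \sum_(i < m) c x i *: F (z i))).
  rewrite subrKA !opprB (addrC (\sum_(i < m) _) (F x - _)) addrACA.
  by rewrite [F (u d x) + _]addrC subrK [- L x + _]addrC.
apply: (le_trans (hB _ _)); rewrite -!mulrA ler_wpM2l //.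
have -> : (D * (2 + 1) + C * M) * (Q * qnorm x) =
   C * (Q * M) * qnorm x + D * (Q * (qnorm x + qnorm x) + Q * qnorm x) by ring.
apply: lerD; first exact: hL.
by apply: (le_trans (hD _ _)); rewrite ler_wpM2l // lerD.
Qed.

(** The local linear maps are indexed by finite lists, along an ultrafilter
    containing the lists that have any prescribed element. *)
Lemma bap_domain_K_const (X Y : quasiBanachType R k) :
  bounded_approximation_property X -> ultrasummand Y ->
  (K0_const X Y < +oo)%E -> (K_const X Y < +oo)%E.
Proof.
move=> bapX usY K0; have [B B0 hB] := bap_finite_linear_approx bapX K0.
pose G : set_system (seq X) :=
  filter_from setT (fun s : seq X => [set t : seq X | {subset s <= t}]).
have PG : ProperFilter G.
  apply: filter_from_proper; last by move=> s _; exists s.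
  apply: filter_from_filter; first by exists [::].
  move=> s t _ _; exists (s ++ t) => // r /= str.
  by split=> x xs; apply: str; rewrite mem_cat xs ?orbT.
have [U [FU GU]] := ultraFilterLemma PG.
have Umem x : \forall s \near U, x \in s.
  by apply: GU; exists [:: x] => // s /=; apply; rewrite inE.
have [P P0 hP] := ultrasummand_lift FU usY.
apply/K_const_ltyP; exists (P * B) => [|F Q sF FQ]; first exact: mulr_ge0.
have [Q0 _] := FQ.
have /choice[l hl] := hB F Q sF FQ.
have [|x e e0|x|a x y|L hL] := hP X F (fun=> F) l (B * Q).
- exact: mulr_ge0.
- by apply: nearW => s; rewrite subrr qnorm0.
- by apply: filterS (Umem x) => s xs; exact: (hl s).2.
- near=> s; apply: (hl s).1; near: s; exact: Umem.
- by exists L => x; rewrite -(mulrA P).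
Unshelve. all: by end_near. Qed.

(** Subtracting the linear map [A] makes [v d \o F] bounded without changing its
    quasilinear constant.  [A] itself may be discontinuous, which is harmless: it
    is added back to the linear map close to the difference. *)
Lemma bap_codomain_K_const (X Y : quasiBanachType R k) :
  K_space X -> ultrasummand Y -> bounded_approximation_property Y ->
  (K0_const X Y < +oo)%E -> (K_const X Y < +oo)%E.
Proof.
move=> /K_const_ltyP[C1 C10 hC1] usY /bap_net[I [G [v [M [PG M0 vM fv vy]]]]].
move=> /K0_const_ltyP[C C0 hC].
have [U [FU GU]] := ultraFilterLemma PG.
have [P P0 hP] := ultrasummand_lift FU usY.
apply/K_const_ltyP; exists (P * (C * M)) => [|F Q sF FQ]; first by rewrite !mulr_ge0.
have [Q0 hQ] := FQ.
have /choice[l hl] d : exists l : {linear X -> Y},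
    forall x, qnorm (v d (F x) - l x) <= C * (M * Q) * qnorm x.
  have [m [e [c [N [N0 hv hN]]]]] := finite_rank_coords (vM d) (fv d).
  have /choice[t ht] i : exists t : {linear X -> (scalar R k)^o},
      forall x, qnorm (c i (F x) - t x) <= C1 * (N * Q) * qnorm x.
    apply: (hC1 (c i \o F)); first by move=> a x /=; rewrite sF linearZ.
    exact: quasilinear_constants_compl N0 (hN i) FQ.
  have [A hA] : exists A : {linear X -> Y}, forall x,
      A x = \sum_(i < m) (t i x : scalar R k) *: e i.
    apply: linear_bundle => a x y; rewrite scaler_sumr -big_split.
    by apply: eq_bigr => i _; rewrite linearP scalerDl scalerA.
  pose H x := v d (F x) - A x.
  have sH : scalable H.
    by move=> a x; rewrite /H scalerBr sF (linearZ_LR (v d)) (linearZ_LR A).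
  have HQ : quasilinear_constants H (M * Q).
    have [MQ0 hMQ] := quasilinear_constants_compl M0 (vM d) FQ; split=> // x y.
    apply: le_trans (hMQ x y); rewrite /H /= linearD.
    rewrite -!addrA -!opprD [_ - A x + _]addrACA -opprD [A x + A y + _]addrC subrK.
    by rewrite lexx.
  have [S S0 hS] := qnorm_comb_ex m e.
  have bH : bounded_map H.
    apply/bounded_mapP => //; exists (S * (C1 * (N * Q) *+ m)) => x.
    have -> : H x = \sum_(i < m) (c i (F x) - t i x : scalar R k) *: e i.
      by rewrite /H hv hA -sumrB; apply: eq_bigr => i _; rewrite scalerBl.
    apply: (le_trans (hS (fun i => c i (F x) - t i x))).
    rewrite -mulrA ler_wpM2l // mulrnAl -[X in _ *+ X]card_ord -sumr_const.
    by apply: ler_sum => i _; exact: ht.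
  have [L hL] := hC H (M * Q) sH HQ bH.
  exists (A \+ L) => x; rewrite /= opprD addrA; exact: hL.
have [|x e e0|x|a x y|L hL] := hP X F (fun d x => v d (F x)) l (C * (M * Q)).
- by rewrite !mulr_ge0.
- by apply: GU; exact: vy.
- by apply: nearW => d; exact: hl.
- by apply: nearW => d; rewrite linearP.
- by exists L => x; have := hL x; rewrite -!mulrA.
Qed.

End approximation.

Local Open Scope ereal_scope.

Theorem theorem3 (R : realType) (k : scalar_kind) :
  (forall X Y : quasiBanachType R k,
     bounded_approximation_property X -> ultrasummand Y ->
     K0_const X Y < +oo -> K_const X Y < +oo) /\
  (forall X Y : quasiBanachType R k,
     K_space X -> ultrasummand Y -> bounded_approximation_property Y ->
     K0_const X Y < +oo -> K_const X Y < +oo).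
Proof.
by split=> X Y; [exact: bap_domain_K_const|exact: bap_codomain_K_const].
Qed.
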